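(* For every (finite, simple) graph $G$, $$\chi_T(G) \le \Delta(G)+2\left\lceil \frac{|V(G)|}{\Delta(G)+1}\right\rceil .$$
   Context: A total coloring of a graph $G$ is an assignment of colors to the vertices and edges of $G$ such that adjacent vertices receive different colors, adjacent edges (edges sharing an endpoint) receive different colors, and every edge receives a color different from the colors of both of its endpoints. The total chromatic number $\chi_T(G)$ is the minimum number of colors in a total coloring of $G$. $\Delta(G)$ denotes the maximum degree of $G$. *)

(* Defs.v *)
From HB Require Import structures.
From mathcomp Require Import all_boot all_order all_algebra.
Set Implicit Arguments.
Unset Strict Implicit.
Unset Printing Implicit Defensive.

Record sgraph := SGraph {
  vertex :> finType;
  adj : rel vertex;
  adj_sym : symmetric adj;
  adj_irr : irreflexive adj }.

Section TotalColoring.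
Variable G : sgraph.

Definition nbhd (x : G) : {set G} := [set y | adj x y].

(* On the empty graph the maximum is 0. *)
Definition max_degree : nat := \max_(x : G) #|nbhd x|.

Definition edges : {set {set G}} :=
  [set A | [exists x : G, exists y : G, adj x y && (A == [set x; y])]].

Definition edge : Type := {A : {set G} | A \in edges}.

HB.instance Definition _ := SubFinite.on edge.

(* The objects to be coloured: vertices (inl) and edges (inr). Edges form a
   subtype, so only genuine edges carry a colour. *)
Definition element : Type := (G + edge)%type.

HB.instance Definition _ := Finite.on element.

Definition adjacent_edges (a b : edge) : bool :=
  (a != b) && (val a :&: val b != set0).

Definition total_coloring (C : eqType) (f : element -> C) : bool :=
  [&& [forall x : G, forall y : G, adj x y ==> (f (inl x) != f (inl y))],
      [forall a : edge, forall b : edge,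
         adjacent_edges a b ==> (f (inr a) != f (inr b))]
    & [forall x : G, forall a : edge,
         (x \in val a) ==> (f (inl x) != f (inr a))]].

Definition total_colorable (k : nat) : bool :=
  [exists f : {ffun element -> 'I_k}, total_coloring f].

Lemma total_colorable_exists : exists k, total_colorable k.
Proof.
exists #|{: element}|; apply/existsP; exists [ffun u => enum_rank u].
apply/and3P; split; apply/forallP=> x; apply/forallP=> y; apply/implyP;
  rewrite !ffunE (inj_eq enum_rank_inj).
- by apply: contraTneq => -[->]; rewrite adj_irr.
- by case/andP=> neq_xy _; apply: contra neq_xy => /eqP[->].
- by [].
Qed.

Definition total_chromatic_number : nat := ex_minn total_colorable_exists.

End TotalColoring.

(* Main.v *)
Require Import Defs.
From mathcomp Require Import all_boot all_order all_algebra perm.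
From mathcomp Require Import zify.

(* Let D be the maximum degree and k = ceil(n / (D + 1)). By the Hajnal-Szemeredi theorem G has
   a proper vertex colouring c with D + 1 colours and classes of size at most k; the proof given
   here is the one of Kierstead and Kostochka. With D + 2k colours available, c extends to a
   total colouring edge by edge, as in Vizing's theorem. If uv is the uncoloured edge and the
   fan at u cannot be shifted, counting missing colours gives a colour beta missing at 2k vertices
   of the fan. Let alpha be missing at u. Those 2k vertices and u are 2k + 1 ends of
   alpha/beta-chains. A chain can be switched unless it contains a vertex x with c x in
   {alpha, beta}; such a vertex is an end of its chain and there are at most 2k of them, so one
   of the 2k + 1 ends lies on a chain that can be switched, after which the fan can be shifted. *)

Set Implicit Arguments.
Unset Strict Implicit.
Unset Printing Implicit Defensive.

Import Order.TTheory GRing.Theory Num.Theory.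

(** * Edge colourings avoiding a vertex colouring *)

(** The number [2k] is where two counts meet. Switching two colours on a chain can give an edge the
    colour of one of its ends, so a chain is switched only if none of its vertices has one of the
    two as its own colour. Classes of size at most [k] leave at most [2k] obstructing vertices; a
    greedy vertex colouring would not control this number. On the other side, with [D + 2k] colours
    every vertex misses at least [2k - 1], one being lost to its own colour, and [v], whose edge to
    [u] is uncoloured, misses one more; this surplus lifts the average multiplicity of a colour on
    the fan above [2k - 1]. The vertex colouring is built by inserting one vertex at a time. A class
    is accessible if vertices can be shifted from it, class by class, to a class with room. When the
    new vertex has neighbours in all accessible classes, an exchange between an accessible class and
    the remaining vertices either completes the colouring or makes one more class accessible;
    discharging shows that such an exchange exists. *)

Section AlternatingPaths.

Variables (T : finType) (a b : T -> T).
Hypotheses (aK : involutive a) (bK : involutive b).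

(** An involution encodes a matching, its fixed points being the unmatched vertices. *)
Definition alt_step : rel T := fun x y => (y == a x) || (y == b x).
Definition alt : rel T := connect alt_step.

Lemma alt_sym : symmetric alt.
Proof.
apply: sym_connect_sym => x y; rewrite /alt_step.
by rewrite -(can_eq aK y) -(can_eq bK y) aK bK ![_ == x]eq_sym.
Qed.

Lemma alt_closed (A : pred T) x y :
  (forall z, A z -> A (a z) && A (b z)) -> A x -> alt x y -> A y.
Proof.
move=> clA Ax /connectP[p]; elim: p x Ax => [|z p IHp] x Ax /=; first by move=> _ ->.
by case/andP=> /orP[]/eqP->; apply: IHp; case/andP: (clA _ Ax).
Qed.

Fixpoint alt_walk x n :=
  if n is n'.+1 then (if odd n' then b else a) (alt_walk x n') else x.

(** The neighbours of a position are the next and the previous one; at the start, [0.-1 = 0]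
    accounts for the fixed point [b x = x]. *)
Lemma alt_walk_step x n : b x = x ->
  (a (alt_walk x n) == alt_walk x n.+1) && (b (alt_walk x n) == alt_walk x n.-1)
  || (a (alt_walk x n) == alt_walk x n.-1) && (b (alt_walk x n) == alt_walk x n.+1).
Proof.
move=> bx; case: n => [|n] /=; first by rewrite bx !eqxx.
by case: (odd n); rewrite /= ?aK ?bK !eqxx ?orbT.
Qed.

Lemma alt_walkP x y : b x = x -> alt x y -> exists n, alt_walk x n == y.
Proof.
move=> bx xy.
suff: forall p z, path alt_step z p -> (exists n, alt_walk x n == z) ->
    exists n, alt_walk x n == last z p.
  by case/connectP: xy => p xp -> suffp; apply: suffp xp _; exists 0.
elim=> [|w p IHp] z //= /andP[zw wp] [n /eqP nz]; apply: (IHp w wp).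
have := alt_walk_step n bx; rewrite nz.
by case/orP: zw => /eqP->; case/orP=> /andP[/eqP e1 /eqP e2]; rewrite ?e1 ?e2;
  eexists; apply: eqxx.
Qed.

Definition alt_end x := (a x == x) || (b x == x).

(** At its first visit to the end [y] the walk stalls: the involution fixing [y] cannot be the one
    leading back, since the previous position differs from [y]. The positions up to [n] are then
    closed under [a] and [b]. *)
Lemma alt_walk_end x y : b x = x -> alt x y -> alt_end y -> y != x ->
  exists n, [/\ alt_walk x n = y, forall m, alt_walk x m = y -> n <= m
     & forall z, alt x z -> exists2 m, m <= n & alt_walk x m = z].
Proof.
move=> bx xy ey yx; have exn := alt_walkP bx xy.
case: (ex_minnP exn) => n /eqP ny minn; exists n; split=> // [m /eqP|z xz]; first exact: minn.
have n_gt0 : 0 < n by case: n ny {minn} => //= xy'; rewrite xy' eqxx in yx.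
have stop : alt_walk x n.+1 = y.
  have back : (y == alt_walk x n.-1) = false.
    by apply/negP=> /eqP yE; have := minn n.-1; rewrite -yE eqxx => /(_ isT); lia.
  have := alt_walk_step n bx; rewrite ny; case/orP: ey => /eqP yE; rewrite yE back.
    by rewrite orbF => /andP[/eqP].
  by rewrite andbF /= => /andP[_ /eqP].
pose A := [pred z | [exists m : 'I_n.+1, alt_walk x m == z]].
suff clA : forall z, A z -> A (a z) && A (b z).
  have Ax : A x by apply/existsP; exists ord0.
  have /existsP[m /eqP mz] := alt_closed clA Ax xz.
  by exists m => //; rewrite -ltnS.
move=> w /existsP[m /eqP <-]; have := alt_walk_step m bx.
have prev : [exists m' : 'I_n.+1, alt_walk x m' == alt_walk x m.-1].
  have lt_m : m.-1 < n.+1 by have := ltn_ord m; lia.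
  by apply/existsP; exists (Ordinal lt_m).
have next : [exists m' : 'I_n.+1, alt_walk x m' == alt_walk x m.+1].
  have [lt_m|ge_m] := ltnP m n; first by apply/existsP; exists (Ordinal (lt_m : m.+1 < n.+1)).
  have -> : m = n :> nat by have := ltn_ord m; lia.
  by apply/existsP; exists ord_max; rewrite stop ny.
by case/orP=> /andP[/eqP-> /eqP->]; rewrite /= prev next.
Qed.

(** Each of the two ends is visited by the time of the first visit to the other, so both first
    visits happen at the same time. *)
Lemma alt_end_uniq x y z : b x = x -> alt x y -> alt x z -> alt_end y -> alt_end z ->
  y != x -> z != x -> y = z.
Proof.
move=> bx xy xz ey ez yx zx.
have [n [ny minn alln]] := alt_walk_end bx xy ey yx.
have [m [mz minm allm]] := alt_walk_end bx xz ez zx.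
have [i le_in iz] := alln z xz; have [j le_jm jy] := allm y xy.
have := minm _ iz; have := minn _ jy => le_nj le_mi.
by rewrite -ny -mz; congr alt_walk; lia.
Qed.

End AlternatingPaths.

(* A component of a union of two matchings is a path or a cycle. *)
Lemma alt_ends (T : finType) (a b : T -> T) x y z :
    involutive a -> involutive b -> alt_end a b x -> alt_end a b y -> alt_end a b z ->
  alt a b x y -> alt a b x z -> [|| x == y, x == z | y == z].
Proof.
move=> aK bK ex ey ez xy xz.
have [//|yx] := eqVneq x y; have [//|zx] := eqVneq x z; rewrite /=; apply/eqP.
rewrite eq_sym in yx; rewrite eq_sym in zx.
have swap : alt b a =2 alt a b by apply: eq_connect => ? ?; rewrite /alt_step orbC.
case/orP: ex => /eqP ex; last exact: (alt_end_uniq aK bK ex).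
by apply: (alt_end_uniq bK aK ex); rewrite ?swap // /alt_end orbC.
Qed.

(** * Partial edge colourings, fans and Kempe swaps *)

Section EdgeColouring.

Variables (T C : finType) (c : T -> C).
Implicit Types (h : rel T) (phi : T -> T -> option C) (u v x y z : T) (i : C).

(** The last clause speaks of one end of an edge; symmetry of [phi] gives it for the other. *)
Definition edge_colouring h phi :=
  [/\ forall x y, phi x y = phi y x,
      forall x y, (phi x y != None) = h x y,
      forall x y z i, phi x y = Some i -> phi x z = Some i -> y = z
    & forall x y, phi x y != Some (c x)].

Definition missing phi x := [set i | (i != c x) && [forall y, phi x y != Some i]].

Lemma missingP phi x i :
  reflect (i != c x /\ forall y, phi x y != Some i) (i \in missing phi x).
Proof. by rewrite inE; apply: (iffP andP) => -[-> /forallP]. Qed.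

Lemma card_missing h phi x : edge_colouring h phi ->
  #|C| <= #|missing phi x| + #|[set y | h x y]| + 1.
Proof.
case=> _ dom _ _; rewrite -(cardsC (missing phi x)) -addnA leq_add2l.
have sub : ~: missing phi x \subset
    c x |: [set odflt (c x) (phi x y) | y in [set y | h x y]].
  apply/subsetP=> i; rewrite !inE negb_and negbK; case: eqP => //= _.
  rewrite negb_forall => /existsP[y]; rewrite negbK => /eqP xy.
  by apply/imsetP; exists y; rewrite ?inE -?dom xy.
apply: leq_trans (subset_leq_card sub) _.
rewrite cardsU1 addnC; apply: leq_add; first exact: leq_imset_card.
by case: (_ \notin _).
Qed.

Definition hole u v : rel T :=
  fun x y => (x == u) && (y == v) || (x == v) && (y == u).
Definition del_edge h u v : rel T := fun x y => h x y && ~~ hole u v x y.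
Definition upd phi u v o := fun x y => if hole u v x y then o else phi x y.

Lemma hole_sym u v x y : hole u v x y = hole u v y x.
Proof. by rewrite /hole orbC andbC [(x == u) && _]andbC. Qed.

Lemma eq_edge_colouring h1 h2 phi :
  h1 =2 h2 -> edge_colouring h1 phi -> edge_colouring h2 phi.
Proof. by move=> eqh [s d p n]; split=> // x y; rewrite d eqh. Qed.

Lemma colouring_del_edge h phi u v : edge_colouring h phi ->
  edge_colouring (del_edge h u v) (upd phi u v None).
Proof.
case=> s d p n; split=> [x y|x y|x y z i|x y]; rewrite /upd /del_edge.
- by rewrite hole_sym s.
- by case: (hole _ _ _ _); rewrite ?andbF ?andbT ?eqxx.
- by do 2!case: (hole _ _ _ _) => //; apply: p.
- by case: (hole _ _ _ _).
Qed.

Lemma missing_upd_None phi u v x : missing phi x \subset missing (upd phi u v None) x.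
Proof.
apply/subsetP=> i /missingP[nc fr]; apply/missingP; split=> // y.
by rewrite /upd; case: (hole _ _ _ _).
Qed.

Lemma colouring_add_edge h phi u v i :
    edge_colouring h phi -> u != v -> ~~ h u v ->
    i \in missing phi u -> i \in missing phi v ->
  edge_colouring (fun x y => h x y || hole u v x y) (upd phi u v (Some i)).
Proof.
case=> s d p n uv huv /missingP[ncu fu] /missingP[ncv fv].
split=> [x y|x y|x y z j|x y]; rewrite /upd.
- by rewrite hole_sym s.
- by case: (hole _ _ _ _); rewrite ?orbT ?orbF.
- rewrite /hole; have [->|xu] := eqVneq x u; last have [->|xv] := eqVneq x v;
    rewrite /= ?(negPf uv) /= ?orbF.
  + have [->|yv] := eqVneq y v; have [->|zv] := eqVneq z v => //.
    * by case=> <-; move/eqP; rewrite (negPf (fu _)).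
    * by move/eqP=> uy [ij]; rewrite -ij (negPf (fu _)) in uy.
    * exact: p.
  + have [->|yv] := eqVneq y u; have [->|zv] := eqVneq z u => //.
    * by case=> <-; move/eqP; rewrite (negPf (fv _)).
    * by move/eqP=> uy [ij]; rewrite -ij (negPf (fv _)) in uy.
    * exact: p.
  + exact: p.
- case hxy: (hole _ _ _ _); last exact: n.
  by case/orP: hxy => /andP[/eqP-> _]; apply/eqP=> -[iE]; rewrite iE eqxx in ncu ncv.
Qed.

(** An arc from [x] to [y] means that the colour of [uy] may be moved to [ux]. With a relation in
    place of a sequence, the vertices reachable from [v] form the maximal fan. *)
Definition fan phi u : rel T :=
  fun x y => if phi u y is Some i then i \in missing phi x else false.

(** The colour of [uy] moves to [uv], and [uy] becomes the uncoloured edge. No colour stops being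
    missing at the later vertices of the path, because it has no repetition, so the rest is still a
    fan path; at its end [g] is free on both sides. *)
Lemma fan_shift_path h u v phi p g :
    symmetric h -> irreflexive h -> h u v ->
    edge_colouring (del_edge h u v) phi ->
    path (fan phi u) v p -> uniq (v :: p) ->
    g \in missing phi u -> g \in missing phi (last v p) ->
  exists psi, edge_colouring h psi.
Proof.
move=> hs hi; elim: p v phi => [|y p IHp] v phi huv col /=.
  move=> _ _ gu gv; exists (upd phi u v (Some g)).
  have uv : u != v by apply: contraTneq huv => ->; rewrite hi.
  have NN : ~~ del_edge h u v u v by rewrite /del_edge /hole !eqxx andbF.
  have := colouring_add_edge col uv NN gu gv.
  apply: eq_edge_colouring => x y; rewrite /del_edge.
  case E: (hole u v x y); rewrite ?orbT ?andbT ?orbF //.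
  by case/orP: E => /andP[/eqP-> /eqP->] //; rewrite hs.
case/andP; rewrite {1}/fan; case uyE: (phi u y) => [i|//] iv yp.
rewrite inE negb_or -andbA => /and4P[vy vp yNp up] gu gl.
have uv : u != v by apply: contraTneq huv => ->; rewrite hi.
have huy : del_edge h u v u y by case: (col) => _ <- _ _; rewrite uyE.
have uy : u != y by apply: contraTneq huy => ->; rewrite /del_edge hi.
set phi1 := upd (upd phi u y None) u v (Some i).
have ifu : i \in missing (upd phi u y None) u.
  case: (col) => s d pr n; apply/missingP; split.
    by apply: contraNneq (n u y) => <-; rewrite uyE.
  move=> z; rewrite /upd; case E: (hole u y u z) => //.
  by apply/negP=> /eqP uz; rewrite (pr _ _ _ _ uyE uz) /hole !eqxx in E.
have ifv : i \in missing (upd phi u y None) v by apply: (subsetP (missing_upd_None _ _ _ _)).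
have col1 : edge_colouring (del_edge h u y) phi1.
  have NN : ~~ del_edge (del_edge h u v) u y u v.
    by rewrite /del_edge /hole !eqxx /= andbF.
  have := colouring_add_edge (colouring_del_edge u y col) uv NN ifu ifv.
  apply: eq_edge_colouring => x z; rewrite /del_edge.
  case E: (hole u v x z); rewrite /= ?andbT ?andbF ?orbF ?orbT; last first.
    by case: (h x z).
  have -> : h x z by case/orP: E => /andP[/eqP-> /eqP->] //; rewrite hs.
  apply/esym; case/orP: E => /andP[/eqP-> /eqP->];
    by rewrite /hole ?(negPf vy) ?(negPf uy) ?(negPf uv) ?[v == u]eq_sym ?(negPf uv) ?andbF.
have phi1E z w : z != u -> z != v -> phi1 z w = upd phi u y None z w.
  by move=> zu zv; rewrite /phi1 {1}/upd /hole (negPf zu) (negPf zv).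
have free1 z : z != u -> z != v -> {subset missing phi z <= missing phi1 z}.
  move=> zu zv j /(subsetP (missing_upd_None _ u y _)) /missingP[nc fr].
  by apply/missingP; split=> // w; rewrite phi1E.
have phiuv : phi u v = None.
  by case: (col) => _ d _ _; apply/eqP; rewrite -[_ == _]negbK d /del_edge /hole !eqxx andbF.
have phiuu : phi u u = None.
  by case: (col) => _ d _ _; apply/eqP; rewrite -[_ == _]negbK d /del_edge hi.
have uNp : u \notin y :: p.
  rewrite inE (negPf uy) /=; apply/negP => /(path.splitPr (p := p)).
  move=> sp; case: sp yp => p1 p2; rewrite cat_path /= => /and3P[_].
  by rewrite /fan phiuu.
have off z : z \in y :: p -> (z != u) && (z != v).
  move=> zp; rewrite (contraNneq _ uNp) => [|<-] //=.
  by apply: contraTneq zp => ->; rewrite inE negb_or vy.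
have phi1uE z : z != v -> z != y -> phi1 u z = phi u z.
  by move=> zv zy; rewrite /phi1 /upd /hole (negPf zv) (negPf zy) (negPf uv) (negPf uy) !andbF.
apply: (IHp y phi1) => //.
- by case/andP: huy.
- apply/(pathP u) => n lt_np; have := pathP u yp n lt_np; rewrite /fan.
  have zp : nth u (y :: p) n \in y :: p by rewrite mem_nth //= ltnW.
  have wp : nth u p n \in p by rewrite mem_nth.
  have /andP[_ wv] : (nth u p n != u) && (nth u p n != v) by rewrite off // inE wp orbT.
  rewrite phi1uE //; last by apply: contraNneq yNp => <-.
  case: (phi u _) => // j; have /andP[zu zv] := off _ zp; exact: free1.
- by rewrite /= yNp.
- case/missingP: (gu) => gc gfr; apply/missingP; split=> // z; rewrite /phi1 /upd.
  case: (hole u v u z); first by rewrite -uyE.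
  by case: (hole u y u z).
- by have /andP[? ?] := off _ (mem_last y p); apply: free1.
Qed.

Lemma fan_shift h u v x phi g :
    symmetric h -> irreflexive h -> h u v -> edge_colouring (del_edge h u v) phi ->
    connect (fan phi u) v x -> g \in missing phi u -> g \in missing phi x ->
  exists psi, edge_colouring h psi.
Proof.
move=> hs hi huv col /connectP[p vp ->] gu; case/shortenP: vp => p' vp' up' _ gx.
exact: (fan_shift_path hs hi huv col vp' up' gu gx).
Qed.

Section KempeSwap.

Variables (h : rel T) (phi : T -> T -> option C) (al be : C) (K : pred T).
Hypothesis col : edge_colouring h phi.
Hypothesis K_closed : forall x y,
  (phi x y == Some al) || (phi x y == Some be) -> K x = K y.
Hypothesis K_avoid : forall x, K x -> (c x != al) && (c x != be).

(** By [K_closed], [K] is a union of chains; by [K_avoid], no vertex in it has [al] or [be] as its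
    own colour. *)
Definition kempe x y := if K x then omap (tperm al be) (phi x y) else phi x y.

Lemma tperm_omap (o : option C) : ~~ ((o == Some al) || (o == Some be)) ->
  omap (tperm al be) o = o.
Proof.
case: o => [i|] //=; rewrite !(inj_eq Some_inj) => /norP[ia ib].
by rewrite tpermD // eq_sym.
Qed.

Lemma kempe_colouring : edge_colouring h kempe.
Proof.
case: col => s d p n; rewrite /kempe; split=> [x y|x y|x y z i|x y].
- rewrite (s y x); case E: ((phi x y == Some al) || (phi x y == Some be)).
    by rewrite (K_closed E).
  by rewrite !tperm_omap ?E // !if_same.
- by rewrite -d; case: (K x) => //; case: (phi x y).
- case: (K x); last exact: p.
  case yE: (phi x y) => [j|] //=; case zE: (phi x z) => [k|] //= [<-] [].
  by move/perm_inj => kj; apply: p yE _; rewrite zE kj.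
- case Kx: (K x) => //; have /andP[ca cb] := K_avoid Kx.
  apply: contra (n x y); case: (phi x y) => [j|] //=.
  rewrite !(inj_eq Some_inj) => /eqP jc.
  by rewrite -(inj_eq (@perm_inj _ (tperm al be))) jc tpermD // eq_sym.
Qed.

Lemma missing_kempe x i :
  (i \in missing kempe x) = ((if K x then tperm al be i else i) \in missing phi x).
Proof.
rewrite !inE /kempe; case Kx: (K x) => //; have /andP[ca cb] := K_avoid Kx.
have cE : tperm al be (c x) = c x by rewrite tpermD // eq_sym.
rewrite -{2}cE (inj_eq perm_inj); congr (_ && _); apply: eq_forallb => y; congr (~~ _).
case: (phi x y) => [j|] //=; rewrite !(inj_eq Some_inj).
by rewrite -(inj_eq (@perm_inj _ (tperm al be))) tpermK.
Qed.

End KempeSwap.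

(** As exactly one of [u] and [x] lies in [K], after the swap the colour [g] is missing at both:
    [be] if [u] is in [K], and [al] otherwise. *)
Lemma fan_kempe h u v x phi al be (K : pred T) :
    symmetric h -> irreflexive h -> h u v -> edge_colouring (del_edge h u v) phi ->
    (forall x y, (phi x y == Some al) || (phi x y == Some be) -> K x = K y) ->
    (forall x, K x -> (c x != al) && (c x != be)) ->
    connect (fan phi u) v x -> al \in missing phi u -> be \in missing phi x ->
    K u != K x ->
  exists psi, edge_colouring h psi.
Proof.
move=> hs hi huv col Kcl Kav vx au bx uxK; set phi' := kempe phi al be K.
have col' : edge_colouring (del_edge h u v) phi' by apply: kempe_colouring.
pose g := if K u then be else al.
have gu : g \in missing phi' u.
  by rewrite missing_kempe // /g; case: (K u); rewrite ?tpermR.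
have gx' y : be \in missing phi y -> K u != K y -> g \in missing phi' y.
  by rewrite missing_kempe // /g; case: (K u); case: (K y); rewrite ?tpermL.
have [p vp xE] := connectP vx.
(* The swap may destroy an arc of the fan, but only one from [y] to [z] with [uz] coloured [be] and
   [u], [y] on different sides of [K]. Then [y] itself misses [g], and the fan can be shifted up to
   [y]. *)
have: connect (fan phi' u) v (last v p) \/
      exists2 y, connect (fan phi' u) v y & g \in missing phi' y.
  elim/last_ind: p vp {xE} => [|p z IHp]; first by left.
  rewrite last_rcons rcons_path => /andP[vp]; case: (IHp vp) => [vy|]; last by right.
  set y := last v p in vy *; rewrite {1}/fan; case uzE: (phi u z) => [i|//] iy.
  have ia : i != al.
    by apply: contraTneq au => <-; apply/missingP=> -[_ /(_ z)]; rewrite uzE eqxx.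
  have [ib|ib] := eqVneq i be.
    have [uy|uy] := eqVneq (K u) (K y); last first.
      by right; exists y => //; apply: gx' => //; rewrite -ib.
    left; apply: connect_trans vy (connect1 _).
    rewrite /fan /phi' {1}/kempe uzE; case Ku: (K u); rewrite /= missing_kempe // -uy Ku.
      by rewrite ib tpermR tpermL -ib.
    by [].
  left; apply: connect_trans vy (connect1 _).
  have ti : tperm al be i = i by rewrite tpermD // eq_sym.
  have -> : fan phi' u y z = (i \in missing phi' y).
    by rewrite /fan /phi' /kempe uzE; case: (K u); rewrite /= ?ti.
  by rewrite missing_kempe // ti if_same.
rewrite -xE; case=> [vx'|[y vy gy]]; last exact: fan_shift vy gu gy.
by apply: fan_shift vx' gu _ => //; apply: gx'.
Qed.

End EdgeColouring.

(** * Colour classes as matchings, and the extension step *)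

Section Mate.

Variables (T C : finType) (c : T -> C) (h : rel T) (phi : T -> T -> option C).
Hypothesis col : edge_colouring c h phi.
Hypothesis hi : irreflexive h.

Definition mate i x := if [pick y | phi x y == Some i] is Some y then y else x.

Lemma mate_eq i x y : phi x y = Some i -> mate i x = y.
Proof.
case: col => _ _ p _ xy; rewrite /mate; case: pickP => [z /eqP xz|/(_ y)].
  exact: p xz xy.
by rewrite xy eqxx.
Qed.

Lemma mateK i : involutive (mate i).
Proof.
case: (col) => s _ _ _ x; rewrite {2}/mate; case: pickP => [y /eqP xy|noy].
  by apply: mate_eq; rewrite s.
by rewrite /mate; case: pickP => // y; rewrite noy.
Qed.

Lemma mate_missing i x : i \in missing c phi x -> mate i x = x.
Proof. by case/missingP=> _ fr; rewrite /mate; case: pickP => // y; rewrite (negPf (fr y)). Qed.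

Lemma mate_own x : mate (c x) x = x.
Proof. by case: col => _ _ _ n; rewrite /mate; case: pickP => // y; rewrite (negPf (n x y)). Qed.

End Mate.

(* A maximal fan with [m] vertices only offers [m] colours to its vertices: those of its
   [m - 1] coloured edges and [c u]. Since each vertex misses about [#|C| - D] colours,
   some colour is missing that often. *)
Lemma popular_colour (T C : finType) (c : T -> C) h phi (u v : T) D :
    irreflexive h -> symmetric h -> (forall x, #|[set y | h x y]| <= D) -> D < #|C| -> h u v ->
    edge_colouring c (del_edge h u v) phi ->
    (forall x i, connect (fan c phi u) v x -> i \in missing c phi x -> i \notin missing c phi u) ->
  exists be, #|C| - D <= #|[set x | connect (fan c phi u) v x & be \in missing c phi x]|.
Proof.
move=> hi hs hD DC huv col disj; pose X := [set x | connect (fan c phi u) v x].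
have [/existsP//|/existsPn few] := boolP [exists be : C,
  #|C| - D <= #|[set x | connect (fan c phi u) v x & be \in missing c phi x]|].
have vX : v \in X by rewrite inE connect0.
(* The default [c u] already belongs to [L], so it adds no colour. *)
pose L := c u |: [set odflt (c u) (phi u y) | y in X :\ v].
have inL x i : x \in X -> i \in missing c phi x -> i \in L.
  rewrite inE => vx ix; rewrite !inE; case: eqP => //= /eqP icu.
  have := disj _ _ vx ix; rewrite inE icu negb_forall => /existsP[y].
  rewrite negbK => /eqP uy; apply/imsetP; exists y; last by rewrite uy.
  rewrite !inE; apply/andP; split.
    apply: contraPneq uy => ->; case: col => _ d _ _.
    by move/eqP; apply/negP; apply: contraTneq isT => E; have := d u v;
      rewrite E /del_edge /hole !eqxx andbF.
  by apply: connect_trans vx (connect1 _); rewrite /fan uy.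
have card_L : #|L| <= #|X|.
  rewrite cardsU1 (cardsD1 v X) vX; apply: leq_add; first by case: (_ \notin _).
  exact: leq_imset_card.
(* The inequality is strict because the edge from [v] to [u] is uncoloured, which leaves [v] one
   more missing colour. *)
have lower : #|X| * (#|C| - D - 1) < \sum_(x in X) #|missing c phi x|.
  rewrite (bigD1 v) //= -sum_nat_const (bigD1 v) //= -addSn; apply: leq_add.
    have := card_missing v col; have := hD v.
    rewrite (cardsD1 u [set y | h v y]) inE hs huv.
    have : #|[set y | del_edge h u v v y]| <= #|[set y | h v y] :\ u|.
      apply: subset_leq_card; apply/subsetP=> y; rewrite !inE => /andP[-> /norP[_]].
      by rewrite eqxx andbT.
    move: DC; move: #|C| => n /=; lia.
  apply: leq_sum => x _; have := card_missing x col; have := hD x.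
  have : #|[set y | del_edge h u v x y]| <= #|[set y | h x y]|.
    by apply: subset_leq_card; apply/subsetP=> y; rewrite !inE => /andP[].
  by move: #|C| => n; lia.
suff : \sum_(x in X) #|missing c phi x| <= #|X| * (#|C| - D - 1) by lia.
have -> : \sum_(x in X) #|missing c phi x| = \sum_(x in X) \sum_(i in L) (i \in missing c phi x).
  apply: eq_bigr => x xX; rewrite -big_mkcondr /= sum1_card; apply: eq_card => i.
  by rewrite [in RHS]unfold_in /=; case E: (i \in missing c phi x); rewrite ?(inL _ _ xX E) ?andbF.
rewrite exchange_big /=; apply: leq_trans (leq_mul card_L (leqnn _)).
rewrite -sum_nat_const; apply: leq_sum => i _; have := few i.
rewrite -big_mkcondr /= sum1_card.
rewrite (@eq_card _ _ [set x | connect (fan c phi u) v x & i \in missing c phi x]) => [|x].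
  by move: #|C| => n; lia.
by rewrite [in LHS]unfold_in /= !inE.
Qed.

Lemma extend_colouring (T C : finType) (c : T -> C) h phi (u v : T) D k :
    symmetric h -> irreflexive h -> (forall x, #|[set y | h x y]| <= D) ->
    (forall i, #|[set x | c x == i]| <= k) -> 0 < k -> D + k.*2 <= #|C| ->
    h u v -> edge_colouring c (del_edge h u v) phi ->
  exists psi, edge_colouring c h psi.
Proof.
move=> hs hi hD hk k_gt0 DC huv col.
have [/existsP[x /existsP[i /and3P[vx ix iu]]]|disj] := boolP
  [exists x, exists i,
     [&& connect (fan c phi u) v x, i \in missing c phi x & i \in missing c phi u]].
  exact: fan_shift vx iu ix.
have {}disj x i : connect (fan c phi u) v x -> i \in missing c phi x -> i \notin missing c phi u.
  move=> vx ix; apply: contra disj => iu.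
  by apply/existsP; exists x; apply/existsP; exists i; rewrite vx ix iu.
have [al au] : exists al, al \in missing c phi u.
  apply/card_gt0P; have := card_missing u col; have := hD u.
  have : #|[set y | del_edge h u v u y]| <= #|[set y | h u y]|.
    by apply: subset_leq_card; apply/subsetP=> y; rewrite !inE => /andP[].
  move: DC; move: #|C| => n; lia.
have [|be] := popular_colour hi hs hD _ huv col disj; first by move: DC; move: #|C| => n; lia.
set X := [set x | _ & _] => card_X.
have uX : u \notin X.
  by rewrite inE; apply/negP=> /andP[vu bu]; have := disj _ _ vu au; rewrite au.
have Xb x : x \in X -> connect (fan c phi u) v x /\ be \in missing c phi x.
  by rewrite [in X in X -> _]inE => /andP.
pose a := mate phi al; pose b := mate phi be.
have aK : involutive a := mateK col al.
have bK : involutive b := mateK col be.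
have ends x : x \in u |: X -> alt_end a b x.
  rewrite in_setU1 /alt_end => /orP[/eqP->|/Xb[_ bx]].
    by rewrite /a (mate_missing au) eqxx.
  by rewrite /b (mate_missing bx) eqxx orbT.
(* One of [al], [be] is missing at [x] and the other is its own colour, so both matchings fix
   [x]. *)
have isolated x y : x \in u |: X -> (c x == al) || (c x == be) -> alt a b x y -> x = y.
  move=> xP cx; have fix_ab : (a x == x) && (b x == x).
    move: xP; rewrite in_setU1 => /orP[/eqP xu|/Xb[_ bx]].
      move: cx; rewrite xu; case/missingP: (au) => /negPf auc _; rewrite eq_sym auc /= => /eqP cu.
      by rewrite /a /b (mate_missing au) -cu (mate_own col) eqxx.
    case/missingP: (bx) => /negPf bxc _; move: cx; rewrite [c x == be]eq_sym bxc orbF => /eqP cx.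
    by rewrite /a /b (mate_missing bx) -cx (mate_own col) eqxx.
  case/andP: fix_ab => /eqP ax /eqP bx xy.
  have := @alt_closed _ a b (pred1 x) x y _ (eqxx x) xy.
  by move=> /(_ _)/eqP -> // z /= /eqP->; rewrite ax bx eqxx.
(* A chain is blocked when it meets a vertex whose own colour is [al] or [be]; such a vertex
   has at most one chain edge, so it ends its chain, and there are at most [2k] of them. *)
pose bad x := [exists y, alt a b x y && ((c y == al) || (c y == be))].
have [s sP s_good] : exists2 s, s \in u |: X & ~~ bad s.
  apply/exists_inP; rewrite -[X in is_true X]negbK; apply/negP=> /exists_inPn all_bad.
  pose w x := odflt x [pick y | alt a b x y && ((c y == al) || (c y == be))].
  have wP x : x \in u |: X -> alt a b x (w x) && ((c (w x) == al) || (c (w x) == be)).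
    move/all_bad; rewrite negbK /w => /existsP[y xy]; case: pickP => [//|/(_ y)].
    by rewrite xy.
  have asym := alt_sym aK bK.
  (* If [x] and [y] share a blocking vertex, then [x], [y] and that vertex are three ends of one
     chain, so two of them coincide. A blocking vertex equal to [x] or [y] is alone on its chain,
     which again gives [x = y]. *)
  have w_inj : {in u |: X &, injective w}.
    move=> x y xP yP wxy; have /andP[xw cx] := wP x xP; have /andP[yw cy] := wP y yP.
    have xy : alt a b x y by apply: connect_trans xw _; rewrite wxy -/(alt a b _ _) asym.
    have ew : alt_end a b (w x).
      rewrite /alt_end /a /b.
      by case/orP: cx => /eqP <-; rewrite (mate_own col) eqxx ?orbT.
    case/or3P: (alt_ends aK bK (ends x xP) (ends y yP) ew xy xw) => /eqP //.
      by move=> xwE; rewrite -xwE in cx; apply: isolated cx xy.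
    by move=> ywE; rewrite -wxy -ywE in cy; apply/esym; apply: isolated cy _; rewrite // asym.
  have : #|w @: (u |: X)| <= #|[set x | c x == al] :|: [set x | c x == be]|.
    apply: subset_leq_card; apply/subsetP=> _ /imsetP[x xP ->]; rewrite !inE.
    by case/andP: (wP x xP).
  rewrite card_in_imset // cardsU1 uX => le_card.
  have := leq_trans le_card (leq_card_setU _ _); have := hk al; have := hk be; lia.
have K_closed z : forall x y, (phi x y == Some al) || (phi x y == Some be) ->
    alt a b z x = alt a b z y.
  move=> x y xyC; have xy : alt a b x y.
    apply: connect1; rewrite /alt_step /a /b.
    by case/orP: xyC => /eqP /(mate_eq col) ->; rewrite eqxx ?orbT.
  apply/idP/idP => zx; apply: connect_trans zx _ => //.
  by rewrite -/(alt a b _ _) (alt_sym aK bK).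
have K_avoid z : ~~ bad z -> forall x, alt a b z x -> (c x != al) && (c x != be).
  move=> good x zx; rewrite -negb_or; apply: contra good => cx.
  by apply/existsP; exists x; rewrite zx.
(* If the chain of [u] can be switched, it contains at most one vertex of [X], and [X] has at least
   two since [0 < k]. Otherwise [s] lies in [X] and its chain, being good, does not contain [u]. *)
have [u_bad|u_good] := boolP (bad u); last first.
  have [x xX uNx] : exists2 x, x \in X & ~~ alt a b u x.
    have /card_gt1P[x [y [xX yX xy]]] : 1 < #|X| by lia.
    have [ux|] := boolP (alt a b u x); last by exists x.
    have [uy|] := boolP (alt a b u y); last by exists y.
    have [ex ey eu] : [/\ alt_end a b x, alt_end a b y & alt_end a b u].
      by split; apply: ends; rewrite in_setU1 ?xX ?yX ?eqxx ?orbT.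
    have := alt_ends aK bK eu ex ey ux uy; rewrite (negPf xy) orbF.
    by case/orP=> /eqP uE; rewrite uE ?xX ?yX in uX.
  have [vx bx] := Xb x xX.
  apply: (fan_kempe hs hi huv col (K_closed u) (K_avoid u u_good) vx au bx).
  by rewrite (negPf uNx) /alt connect0.
have sX : s \in X.
  by move: sP; rewrite in_setU1; case/orP=> // /eqP su; rewrite su u_bad in s_good.
have [vx bx] := Xb s sX.
apply: (fan_kempe hs hi huv col (K_closed s) (K_avoid s s_good) vx au bx).
have -> : alt a b s s by rewrite /alt connect0.
rewrite eqb_id; apply: contra s_good => su; case/existsP: u_bad => y /andP[uy cy].
by apply/existsP; exists y; rewrite cy andbT; apply: connect_trans su uy.
Qed.

Lemma edge_colouring_exists (T C : finType) (c : T -> C) h D k :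
    symmetric h -> irreflexive h -> (forall x, #|[set y | h x y]| <= D) ->
    (forall i, #|[set x | c x == i]| <= k) -> 0 < k -> D + k.*2 <= #|C| ->
  exists phi, edge_colouring c h phi.
Proof.
move=> hs hi hD hk k_gt0 DC; have [n] := ubnP #|[set p | h p.1 p.2]|.
elim: n h hs hi hD => // n IHn h hs hi hD; rewrite ltnS => le_n.
have [/existsP[u /existsP[v huv]]|no_edge] := boolP [exists u, exists v, h u v].
  have [||x||phi col] := IHn (del_edge h u v).
  - by move=> x y; rewrite /del_edge hole_sym hs.
  - by move=> x; rewrite /del_edge hi.
  - apply: leq_trans (hD x); apply: subset_leq_card.
    by apply/subsetP=> y; rewrite !inE => /andP[].
  - apply: leq_trans le_n; apply: proper_card; apply/properP; split.
      by apply/subsetP=> p; rewrite !inE => /andP[].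
    by exists (u, v); rewrite !inE //= /del_edge /hole !eqxx andbF.
  exact: extend_colouring hs hi hD hk k_gt0 DC huv col.
exists (fun _ _ => None); split=> // x y; apply/esym/negbTE.
by move: no_edge; rewrite negb_exists => /forallP/(_ x); rewrite negb_exists => /forallP/(_ y).
Qed.

(** * The Hajnal-Szemeredi theorem *)

Section Solo.

Variables (T C : finType) (e : rel T).
Hypotheses (e_sym : symmetric e) (e_irr : irreflexive e).

Definition nb (S : {set T}) x := [set y in S | e x y].

Lemma sum_nb (S1 S2 : {set T}) (F : T -> nat) :
  \sum_(x in S1) \sum_(y in nb S2 x) F y = \sum_(y in S2) F y * #|nb S1 y|.
Proof.
rewrite (exchange_big_dep (mem S2)) /= => [|x y _]; last by rewrite inE => /andP[].
apply: eq_bigr => y yS; rewrite sum_nat_const mulnC; congr (_ * _).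
by apply: eq_card => x; rewrite [LHS]unfold_in /= [y \in _]inE [RHS]inE yS /= e_sym.
Qed.

(* [A] stands for the accessible colours and [B] for the vertices outside their classes,
   including the uncoloured one. *)
Variables (S B : {set T}) (f : T -> C) (A A' : {set C}) (U : option C) (k b : nat).
Hypothesis BS : B \subset S.
Hypothesis fA : {in S :\: B, forall x, f x \in A}.

Definition block i := [set x in S :\: B | f x == i].

(** In the application [b] counts the inaccessible colours, whose classes are full, so that [B] has
    [k * b + 1] vertices; [A'] is a smallest nonempty family of accessible classes separated from
    the sink by [U]. *)
Hypothesis degS : {in S, forall x, #|nb S x| < #|A| + b}.
Hypothesis block_le : {in A, forall i, #|block i| <= k}.
Hypothesis B_gt : k * b < #|B|.
Hypothesis B_nb : {in B & A, forall y i, nb (block i) y != set0}.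
Hypothesis A'A : A' \subset A.
Hypothesis A'_gt0 : 0 < #|A'|.
Hypothesis A'_nb : forall i j x,
  i \in A' -> x \in block i -> j \in A :\: A' -> Some j != U -> nb (block j) x != set0.

Lemma deg_split x : x \in S ->
  #|nb B x| + \sum_(i in A) #|nb (block i) x| < #|A| + b.
Proof.
move=> xS; apply: leq_ltn_trans (degS xS).
rewrite -(cardsID B (nb S x)); apply: leq_add.
  by apply: subset_leq_card; apply/subsetP=> y; rewrite !inE => /andP[yB ->]; rewrite (subsetP BS).
rewrite -[#|_ :\: _|]sum1_card (partition_big f (mem A)) /= => [|y].
  apply: leq_sum => i _; rewrite sum1_card; apply: subset_leq_card.
  apply/subsetP=> y; rewrite !inE => /andP[/andP[/andP[yB yS] /eqP fy] xy].
  by rewrite unfold_in /= !inE yB yS xy fy eqxx.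
by rewrite !inE => /andP[yB /andP[yS _]]; apply: fA; rewrite inE yB.
Qed.

Lemma nb_lower x (P : pred C) : x \in S -> (forall i, i \in A -> P i -> nb (block i) x != set0) ->
  #|nb B x| + #|[set i in A | P i]| < #|A| + b.
Proof.
move=> xS hP; apply: leq_ltn_trans (deg_split xS); rewrite leq_add2l.
rewrite -sum1_card (eq_bigl (fun i => (i \in A) && P i)) => [|i]; last by rewrite inE.
rewrite big_mkcondr; apply: leq_sum => i iA.
by case: ifP => // Pi; rewrite card_gt0 hP.
Qed.

(** Every block takes a neighbour of [y], leaving fewer than [b] in [B]. This bound is also what
    allows [B] minus a vertex to be coloured recursively with the [b] inaccessible colours. *)
Lemma nb_B_lt y : y \in B -> #|nb B y| < b.
Proof.
move=> yB; have yS := subsetP BS y yB.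
have := @nb_lower y predT yS (fun i iA _ => B_nb yB iA).
rewrite (_ : [set i in A | predT i] = A); last by apply/setP=> i; rewrite !inE andbT.
by rewrite addnC ltn_add2l.
Qed.

(** These are the vertices of [B] that can replace [z] in its class. *)
Definition solo_set z := [set y in B | nb (block (f z)) y == [set z]].

Lemma solo_block i z y : i \in A -> y \in B -> nb (block i) y = [set z] -> z \in block i /\ f z = i.
Proof.
move=> iA yB E; have : z \in nb (block i) y by rewrite E set11.
by rewrite inE => /andP[zi _]; split=> //; move: zi; rewrite inE => /andP[_ /eqP].
Qed.

(** Every block contains a neighbour of [y], and a block of [A'] without a solo neighbour contains
    at least two. *)
Lemma solo_count y : y \in B ->
  #|nb B y| + #|A'| < b + #|[set i in A' | #|nb (block i) y| == 1]|.
Proof.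
move=> yB; have yS := subsetP BS y yB; have := deg_split yS.
have : #|A| + #|[set i in A' | #|nb (block i) y| != 1]| <= \sum_(i in A) #|nb (block i) y|.
  rewrite -!sum1_card [X in _ + X](eq_bigl (fun i => (i \in A) &&
    ((i \in A') && (#|nb (block i) y| != 1)))) => [|i]; last first.
    rewrite inE; case: (boolP (i \in A')) => [/(subsetP A'A)->|] //=; by rewrite andbF.
  rewrite [X in _ + X]big_mkcondr -big_split; apply: leq_sum => i iA /=.
  have := B_nb yB iA; rewrite -card_gt0.
  by case: ifP => [/andP[_]|_]; move: #|nb _ _| => n; lia.
have : #|A'| = #|[set i in A' | #|nb (block i) y| == 1]| +
               #|[set i in A' | #|nb (block i) y| != 1]|.
  rewrite -(cardsID [set i | #|nb (block i) y| == 1] A').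
  by congr (_ + _); apply: eq_card => i; rewrite !inE // andbC.
lia.
Qed.

Hypothesis no_move : forall z y i, f z \in A' -> y \in solo_set z -> i \in A -> i != f z ->
  nb (block i) z != set0.
Hypothesis clique : forall z y1 y2, f z \in A' -> y1 \in solo_set z -> y2 \in solo_set z ->
  y1 != y2 -> e y1 y2.

(** Suppose [#|A'| <= b]. A vertex of the block [w] with a nonempty [solo_set] has neighbours in all
    other blocks, hence at most [b] in [B]. Any other vertex of [w] can lack neighbours only in
    blocks of [A'] and in [U], hence has at most [b + #|A'|], so at most [2b]. Either way its
    weighted degree is at most [2b], too little for [#|B| > k * b]. *)
Lemma many_terminal : b < #|A'|.
Proof.
have [w wA'] := card_gt0P A'_gt0; have wA := subsetP A'A w wA'.
rewrite ltnNge; apply/negP=> le_tb.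
(* With these weights every vertex of [B] sends at least 2 to the block [w]. *)
pose wt z := if [exists y, y \in solo_set z] then 2 else 1.
have : \sum_(y in B) 2 <= \sum_(z in block w) wt z * #|nb B z|.
  rewrite -sum_nb; apply: leq_sum => y yB; have := B_nb yB wA.
  have [/cards1P[z zE] _|n1 n0] := boolP (#|nb (block w) y| == 1).
    have [_ fz] := solo_block wA yB zE.
    rewrite zE big_set1 /wt; case: existsP => // -[]; exists y.
    by rewrite inE yB fz zE eqxx.
  apply: (@leq_trans (\sum_(z in nb (block w) y) 1)).
    by rewrite sum1_card; move: n0 n1; rewrite -card_gt0; move: #|nb _ _| => n; lia.
  by apply: leq_sum => z _; rewrite /wt; case: ifP.
suff : \sum_(z in block w) wt z * #|nb B z| <= \sum_(z in block w) b.*2.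
  rewrite !sum_nat_const => le1 le2; have := leq_trans le2 le1.
  have := block_le wA; move: B_gt; move: #|B| #|block w| => m n; nia.
apply: leq_sum => z zw; have [zSB fz] : z \in S :\: B /\ f z = w.
  by move: zw; rewrite [in X in X -> _]inE => /andP[? /eqP].
have zS : z \in S by move: zSB; rewrite inE => /andP[].
rewrite /wt; case: existsP => [[y yz]|_].
  have nbA i : i \in A -> i != w -> nb (block i) z != set0.
    by move=> iA iw; apply: no_move yz iA _; rewrite fz.
  have := @nb_lower z (fun i => i != w) zS nbA.
  rewrite (_ : [set i in A | i != w] = A :\ w); last by apply/setP=> i; rewrite !inE andbC.
  have := cardsD1 w A; rewrite wA => ->.
  move: #|nb B z| #|A :\ w| => m n /=; lia.
have nbA i : i \in A -> (i \notin A') && (Some i != U) -> nb (block i) z != set0.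
  by move=> iA /andP[iA' iU]; apply: (A'_nb wA' zw _ iU); rewrite inE iA'.
have := @nb_lower z (fun i => (i \notin A') && (Some i != U)) zS nbA.
have : #|A| <= #|[set i in A | (i \notin A') && (Some i != U)]| + #|A'| + 1.
  apply: (@leq_trans #|[set i in A | (i \notin A') && (Some i != U)] :|: A'
                       :|: [set i | Some i == U]|).
    apply: subset_leq_card; apply/subsetP=> i iA; rewrite !inE iA.
    by case: (i \in A'); case: (Some i == U).
  apply: leq_trans (leq_card_setU _ _) (leq_add (leq_card_setU _ _) _).
  case: (U) => [u|]; last first.
    by rewrite (_ : [set _ | _] = set0) ?cards0 //; apply/setP=> i; rewrite !inE.
  by rewrite (_ : [set _ | _] = [set u]) ?cards1 //; apply/setP=> i; rewrite !inE.
move: le_tb; move: #|nb B z| #|A| #|A'| #|[set i in A | _]| => m n p q; lia.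
Qed.

Local Open Scope ring_scope.

(* Discharging: a solo vertex [z] splits one unit evenly among [solo_set z]. *)
Lemma solo_false : False.
Proof.
have le_bt := many_terminal.
pose Z := [set z in S :\: B | f z \in A'].
pose mu z : rat := (#|solo_set z|%:R)^-1.
(* A vertex with empty [solo_set] gives nothing; its [mu] is the inverse of 0, which is 0. *)
have upper : \sum_(z in Z) \sum_(y in solo_set z) mu z <= (k * #|A'|)%:R.
  apply: (@le_trans _ _ (#|Z|%:R)).
    rewrite -sum1_card natr_sum; apply: ler_sum => z _; rewrite sumr_const /mu.
    rewrite -[X in X <= _]mulr_natl; case: (#|solo_set z|) => [|n]; first by rewrite mul0r.
    by rewrite mulfV // pnatr_eq0.
  rewrite ler_nat -sum1_card (partition_big f (mem A')) /= => [|z]; last by rewrite inE => /andP[].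
  rewrite mulnC -sum_nat_const; apply: leq_sum => i iA'; rewrite sum1_card.
  apply: leq_trans (block_le (subsetP A'A i iA')); apply: subset_leq_card.
  apply/subsetP=> z; rewrite unfold_in /= [z \in Z]inE [z \in block i]inE.
  by case/andP=> /andP[-> _] ->.
have b_gt0 : (0 < b)%N.
  have /card_gt0P[y yB] : (0 < #|B|)%N by apply: leq_ltn_trans B_gt.
  exact: leq_ltn_trans (nb_B_lt yB).
(* By [clique], [solo_set z] lies in [y] and its neighbours in [B], so each solo neighbour gives [y]
   at least [1 / d]. There are [s >= #|A'| - b + d] of them, and [s / d >= #|A'| / b] amounts to
   [(b - d)(#|A'| - b) >= 0]; this is where [many_terminal] enters. *)
have lower : #|B|%:R * (#|A'|%:R / b%:R) <= \sum_(z in Z) \sum_(y in solo_set z) mu z.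
  rewrite (exchange_big_dep (mem B)) /= => [|z y _]; last by rewrite inE => /andP[].
  rewrite mulr_natl -sumr_const; apply: ler_sum => y yB.
  set d := (#|nb B y|).+1%N.
  have le_db : (d <= b)%N by apply: nb_B_lt.
  set s := #|[set i in A' | #|nb (block i) y| == 1%N]|.
  have le_s : (d + #|A'| <= b + s)%N by have := solo_count yB.
  apply: (@le_trans _ _ (s%:R / d%:R)).
    rewrite ler_pdivrMr ?ltr0n // mulrAC ler_pdivlMr ?ltr0n // -!natrM ler_nat.
    move: le_db le_s le_bt; move: #|A'| d s => t d s; nia.
  apply: (@le_trans _ _ (\sum_(z in Z | y \in solo_set z) d%:R^-1)); last first.
    apply: ler_sum => z /andP[zZ yz]; rewrite /mu lef_pV2 ?posrE ?ltr0n //; last first.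
      by apply/card_gt0P; exists y.
    rewrite ler_nat; apply: (@leq_trans #|y |: nb B y|%N); last first.
      by rewrite cardsU1 /d; case: (_ \notin _).
    apply: subset_leq_card; apply/subsetP=> y2 y2z; rewrite in_setU1.
    have [//|ne] := eqVneq y2 y; rewrite inE; apply/andP; split.
      by move: y2z; rewrite inE => /andP[].
    apply: clique yz y2z _; first by move: zZ; rewrite inE => /andP[].
    by rewrite eq_sym.
  rewrite sumr_const -[X in _ <= X]mulr_natl ler_wpM2r ?invr_ge0 ?ler0n // ler_nat.
  have sub : [set i in A' | #|nb (block i) y| == 1%N] \subset
      f @: [set z in Z | y \in solo_set z].
    apply/subsetP=> i; rewrite inE => /andP[iA' /cards1P[z zE]].
    have [zi fz] := solo_block (subsetP A'A i iA') yB zE.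
    apply/imsetP; exists z => //; rewrite [_ \in _]inE; apply/andP; split.
      by rewrite [_ \in _]inE fz iA' andbT; move: zi; rewrite [_ \in _]inE => /andP[].
    by rewrite [_ \in _]inE yB fz zE eqxx.
  apply: leq_trans (leq_trans (subset_leq_card sub) (leq_imset_card _ _)) _.
  by apply: eq_leq; apply: eq_card => z; rewrite [LHS]inE unfold_in.
have := le_trans lower upper; rewrite mulrA ler_pdivrMr ?ltr0n // -!natrM ler_nat.
by move: B_gt le_bt; clear; move: #|B| #|A'| => m n; nia.
Qed.

End Solo.

Local Close Scope ring_scope.

(** * Moving vertices between classes of bounded size *)

Section BoundedColouring.

Variables (T C : finType) (e : rel T) (k : nat).
Hypotheses (e_sym : symmetric e) (e_irr : irreflexive e).
Implicit Types (Q A : {set C}) (D S : {set T}) (f g : T -> C) (V : C -> {set T}).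

Definition cls f D i := [set x in D | f x == i].

(** An upper bound on the classes suffices and makes sense for every [D]; if [#|D| = k * #|Q|] the
    colouring is equitable. *)
Definition bounded_colouring Q D f :=
  [/\ {in D, forall x, f x \in Q}, {in D &, forall x y, e x y -> f x != f y}
    & {in Q, forall i, #|cls f D i| <= k}].

Definition recolour f w j x := if x == w then j else f x.

Lemma eq_cls f g D i : {in D, f =1 g} -> cls f D i = cls g D i.
Proof.
by move=> fg; apply/setP=> x; rewrite !inE; case: (boolP (x \in D)) => // /fg ->.
Qed.

Lemma eq_bounded_colouring Q D f g : {in D, f =1 g} ->
  bounded_colouring Q D f -> bounded_colouring Q D g.
Proof.
move=> fg [fQ fp fk]; split=> [x xD|x y xD yD|i iQ]; rewrite -?fg //.
- exact: fQ.
- exact: fp.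
- by rewrite -(eq_cls i fg) fk.
Qed.

Lemma colouring_restrict Q A D f : bounded_colouring Q D f ->
  A \subset Q -> bounded_colouring A [set x in D | f x \in A] f.
Proof.
case=> fQ fp fk AQ; split=> [x|x y|i iA]; rewrite ?inE.
- by case/andP.
- by move=> /andP[xD _] /andP[yD _]; apply: fp.
- apply: leq_trans (fk i (subsetP AQ i iA)); apply: subset_leq_card.
  by apply/subsetP=> x; rewrite !inE => /andP[/andP[-> _] ->].
Qed.

Lemma colouring_union Q1 Q2 D1 D2 f : [disjoint Q1 & Q2] ->
    bounded_colouring Q1 D1 f -> bounded_colouring Q2 D2 f ->
  bounded_colouring (Q1 :|: Q2) (D1 :|: D2) f.
Proof.
move=> dQ [Q1f p1 k1] [Q2f p2 k2].
have ne x y : x \in D1 -> y \in D2 -> f x != f y.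
  move=> xD yD; apply: contraTneq (Q1f x xD) => ->.
  by rewrite (disjointFl dQ) // Q2f.
split=> [x|x y|i]; rewrite !in_setU.
- by case/orP=> [/Q1f->|/Q2f->]; rewrite ?orbT.
- case/orP=> xD /orP[] yD exy; [exact: p1 | exact: ne | rewrite eq_sym; exact: ne | exact: p2].
- case/orP=> iQ; [apply: leq_trans (k1 i iQ) | apply: leq_trans (k2 i iQ)];
    apply: subset_leq_card; apply/subsetP=> x; rewrite !inE => /andP[/orP[]xD /eqP fx];
    rewrite fx eqxx andbT //.
    by move: (Q2f x xD); rewrite fx (disjointFr dQ).
  by move: (Q1f x xD); rewrite fx (disjointFl dQ).
Qed.

Lemma colouring_add Q D f w j : bounded_colouring Q D f -> w \notin D -> j \in Q ->
    #|cls f D j| < k -> nb e (cls f D j) w == set0 ->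
  bounded_colouring Q (w |: D) (recolour f w j).
Proof.
case=> fQ fp fk wD jQ ltk /eqP nw.
have wj y : y \in D -> e w y -> j != f y.
  move=> yD wy; apply/eqP=> jE; have : y \in nb e (cls f D j) w by rewrite !inE yD wy jE eqxx.
  by rewrite nw inE.
have ne y : y \in D -> y == w = false by move=> yD; apply: contraNF wD => /eqP<-.
have rE y : y \in D -> recolour f w j y = f y by move=> yD; rewrite /recolour ne.
have rw : recolour f w j w = j by rewrite /recolour eqxx.
split=> [x|x y|i iQ]; rewrite ?in_setU1.
- by case/orP=> [/eqP->|xD]; rewrite ?rw ?rE // fQ.
- case/orP=> [/eqP->|xD] /orP[/eqP->|yD]; rewrite ?e_irr ?rw ?rE //.
  + exact: wj.
  + by rewrite e_sym eq_sym; apply: wj.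
  + exact: fp.
- have [->|ij] := eqVneq i j.
    apply: leq_trans ltk; have : cls (recolour f w j) (w |: D) j \subset w |: cls f D j.
      apply/subsetP=> x; rewrite !inE /recolour.
      by case: (x == w).
    by move/subset_leq_card => le; apply: leq_trans le _; rewrite cardsU1; case: (_ \notin _).
  apply: leq_trans (fk i iQ); apply: subset_leq_card; apply/subsetP=> x; rewrite !inE /recolour.
  by case: (x == w) => //=; rewrite eq_sym (negPf ij).
Qed.

Lemma cls_exchange D f w x i : w \notin D -> x \in D ->
  cls (recolour f w (f x)) (w |: D :\ x) i =
  if i == f x then w |: cls f D i :\ x else cls f D i.
Proof.
move=> wD xD; apply/setP=> y; case: (eqVneq i (f x)) => [->|ix]; rewrite !inE /recolour;
  have [->|yw] := eqVneq y w; rewrite ?eqxx //=.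
- by rewrite andbA.
- by rewrite (negPf wD) [f x == i]eq_sym (negPf ix).
- by have [->|//] := eqVneq y x; rewrite [f x == i]eq_sym (negPf ix) !andbF.
Qed.

Lemma colouring_exchange Q D f w x : bounded_colouring Q D f -> w \notin D -> x \in D ->
    nb e (cls f D (f x)) w \subset [set x] ->
  bounded_colouring Q (w |: D :\ x) (recolour f w (f x)).
Proof.
case=> fQ fp fk wD xD nw.
have wj y : y \in D -> y != x -> e w y -> f x != f y.
  move=> yD yx wy; apply: contra yx => /eqP jE.
  have : y \in nb e (cls f D (f x)) w by rewrite !inE yD wy jE eqxx.
  by move/(subsetP nw); rewrite inE.
have ne y : y \in D -> y == w = false by move=> yD; apply: contraNF wD => /eqP<-.
have rE y : y \in D -> recolour f w (f x) y = f y by move=> yD; rewrite /recolour ne.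
have rw : recolour f w (f x) w = f x by rewrite /recolour eqxx.
split=> [y|y z|i iQ]; rewrite ?in_setU1 ?in_setD1.
- by case/orP=> [/eqP->|/andP[_ yD]]; rewrite ?rw ?rE // fQ.
- case/orP=> [/eqP->|/andP[yx yD]] /orP[/eqP->|/andP[zx zD]]; rewrite ?e_irr ?rw ?rE //.
  + exact: wj.
  + by rewrite e_sym eq_sym; apply: wj.
  + exact: fp.
- rewrite cls_exchange //; case: eqP => [iE|_]; last exact: fk.
  apply: leq_trans (fk i iQ); have xc : x \in cls f D i by rewrite inE xD iE eqxx.
  by rewrite (cardsD1 x (cls f D i)) xc cardsU1 leq_add2r leq_b1.
Qed.

(* [None] is a virtual sink reached from every class that is not full. *)
Definition move_rel V Q : rel (option C) := fun p r =>
  if p is Some i then (i \in Q) &&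
    (if r is Some j then [&& j \in Q, i != j & [exists x in V i, nb e (V j) x == set0]]
     else #|V i| < k)
  else false.

Lemma move_rel_sub V V1 Q Q1 p r :
    (forall i, (p == Some i) || (r == Some i) -> i \in Q -> V i = V1 i /\ i \in Q1) ->
  move_rel V Q p r -> move_rel V1 Q1 p r.
Proof.
case: p => // i; rewrite /move_rel => agree /andP[iQ].
have [Vi ->] := agree i ltac:(by rewrite eqxx) iQ; rewrite -Vi /=.
case: r agree => [j|//] agree /and3P[jQ -> ex].
by have [<- ->] := agree j ltac:(by rewrite eqxx orbT) jQ.
Qed.

(** Place [w] in class [j] and expel a vertex [x] that fits into the next class; [x] then plays the
    role of [w]. The remaining path does not return to [j], so its classes are unchanged. *)
Lemma shift_path Q D f w j p : bounded_colouring Q D f -> w \notin D -> j \in Q ->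
    nb e (cls f D j) w == set0 -> path (move_rel (cls f D) Q) (Some j) p ->
    last (Some j) p = None -> uniq (Some j :: p) ->
  exists g, bounded_colouring Q (w |: D) g.
Proof.
elim: p D f w j => // -[j'|] p IHp D f w j col wD jQ nw; last first.
  by move=> /andP[/andP[_ ltk] _] _ _; eexists; apply: colouring_add col wD jQ ltk nw.
rewrite [path _ _ _]/= => /andP[/and4P[_ j'Q jj' /existsP[x /andP[xV nx]]] pp].
move=> lastp /= /andP[jNp up].
have [xD fx] : x \in D /\ f x = j by move: xV; rewrite inE => /andP[? /eqP].
subst j; have col1 := colouring_exchange col wD xD.
have {}col1 := col1 ltac:(by rewrite (eqP nw) sub0set).
have -> : w |: D = x |: (w |: D :\ x).
  by rewrite setUCA setD1K.
have clsE i : i != f x -> cls (recolour f w (f x)) (w |: D :\ x) i = cls f D i.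
  by move=> ix; rewrite cls_exchange // (negPf ix).
apply: (IHp _ _ x j' col1 _ j'Q) => //.
- by rewrite !inE eqxx orbF; apply: contraNneq wD => <-.
- by rewrite clsE // eq_sym.
- have allx : all [pred r | r != Some (f x)] (Some j' :: p).
    by apply/allP=> r rp /=; apply: contraNneq jNp => <-.
  apply: (sub_in_path _ allx pp) => p1 r1 /= p1x r1x.
  apply: move_rel_sub => i iE iQ; split=> //; rewrite clsE //.
  by case/orP: iE => /eqP iE; move: p1x r1x; rewrite iE.
Qed.

Lemma shift_connect Q D f w j : bounded_colouring Q D f -> w \notin D -> j \in Q ->
    nb e (cls f D j) w == set0 -> connect (move_rel (cls f D) Q) (Some j) None ->
  exists g, bounded_colouring Q (w |: D) g.
Proof.
move=> col wD jQ nw /connectP[p jp]; case/shortenP: jp => p' jp' up' _ lastp'.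
by apply: (shift_path col wD jQ nw jp').
Qed.

Section Avoid.

Variables (V : C -> {set T}) (Q : {set C}).

Definition avoid (U : option C) : rel (option C) := fun p r =>
  [&& move_rel V Q p r, p != U & r != U].

Definition acc := [set i | connect (move_rel V Q) (Some i) None].
(* The classes all of whose routes to the sink pass through [U]. *)
Definition cut U := [set i in acc | (Some i != U) && ~~ connect (avoid U) (Some i) None].

Lemma acc_sub : acc \subset Q.
Proof.
apply/subsetP=> i; rewrite inE => /connectP[[|r p]] //=.
by case/andP; rewrite /move_rel => /andP[].
Qed.

Lemma avoid_sub U : subrel (connect (avoid U)) (connect (move_rel V Q)).
Proof. by apply: connect_sub => p r /and3P[pr _ _]; apply: connect1. Qed.

Lemma avoid_neq U W p : connect (avoid U) p None -> ~~ connect (avoid U) (Some W) None ->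
  p != Some W.
Proof. by move=> pU; apply: contraNneq => <-. Qed.

(** A route avoiding [U] cannot visit [W], as its tail would be a route from [W] avoiding [U]. *)
Lemma avoid_switch U W p : connect (avoid U) p None ->
  ~~ connect (avoid U) (Some W) None -> connect (avoid (Some W)) p None.
Proof.
move=> + WU; case/connectP=> s; elim: s p => [|r s IHs] p /=; first by move=> _ <-.
case/andP=> pr rs lasts; apply: connect_trans (connect1 _) (IHs r rs lasts).
have rN : connect (avoid U) r None by apply/connectP; exists s.
have pN : connect (avoid U) p None by apply: connect_trans (connect1 pr) rN.
by rewrite /avoid (avoid_neq pN WU) (avoid_neq rN WU) !andbT; case/and3P: pr.
Qed.

(** Every route ends at the sink, so removing the sink cuts off all accessible classes. This
    provides a first candidate when [U] is chosen with a smallest nonempty cut. *)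
Lemma cut_None : cut None = acc.
Proof.
apply/setP=> i; rewrite inE; case: (boolP (i \in acc)) => //= _.
apply/negP=> /connectP[p]; case/lastP: p => // p r.
by rewrite rcons_path last_rcons => /andP[_ /and3P[_ _ rN]] rE; rewrite -rE in rN.
Qed.

(** Otherwise [W] would have a nonempty cut of its own, contained in that of [U] by [avoid_switch]
    and missing [W], against minimality. *)
Lemma cut_terminal U W X :
    (forall U', cut U' != set0 -> #|cut U| <= #|cut U'|) ->
    W \in cut U -> X \in acc -> X != W -> connect (avoid (Some W)) (Some X) None.
Proof.
move=> minU WU Xacc XW; apply: contraTT isT => XN.
have WN : ~~ connect (avoid U) (Some W) None by move: WU; rewrite inE => /and3P[].
have inW Y : (Y \in cut (Some W)) =
    [&& Y \in acc, Y != W & ~~ connect (avoid (Some W)) (Some Y) None].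
  by rewrite inE (inj_eq Some_inj).
have ne : cut (Some W) != set0 by apply/set0Pn; exists X; rewrite inW Xacc XW.
suff: #|cut (Some W)| < #|cut U| by rewrite ltnNge minU.
apply: proper_card; apply/properP; split; last first.
  by exists W => //; rewrite inW eqxx andbF.
apply/subsetP=> Y; rewrite inW => /and3P[Yacc YW YN].
rewrite inE Yacc /=; apply/andP; split; last first.
  by apply: contra YN => YU; apply: avoid_switch YU WN.
(* It remains to exclude [U] itself from the cut of [W]: a route from [U] without repetition
   continues from a class that avoids [U], hence can also avoid [W]. *)
apply: contra YN => /eqP YU; move: Yacc; rewrite inE => /connectP[p Yp].
case/shortenP: Yp => -[|r p'] //= /andP[Yr rp'] /andP[YNp' _] _ lastp'.
have rN : connect (avoid U) r None.
  apply/connectP; exists p' => //.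
  have allU : all [pred s | s != U] (r :: p').
    by apply/allP=> s sp /=; rewrite -YU; apply: contraNneq YNp' => <-.
  by apply: (sub_in_path _ allU rp') => s1 s2; rewrite !inE /avoid => -> -> ->.
apply: connect_trans (connect1 _) (avoid_switch rN WN).
by rewrite /avoid (avoid_neq rN WN) (inj_eq Some_inj) YW !andbT.
Qed.

(** Routes that avoid [W] survive any change made to the class [W] alone. *)
Lemma avoid_transfer V1 Q1 W p : acc \subset Q1 ->
    (forall i, i \in acc -> i != W -> V i = V1 i) ->
  connect (avoid (Some W)) p None -> connect (move_rel V1 Q1) p None.
Proof.
move=> accQ1 agree /connectP[s]; elim: s p => [|r s IHs] p /=; first by move=> _ <-.
case/andP=> pr rs lasts; apply: connect_trans (connect1 _) (IHs r rs lasts).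
have rN : connect (move_rel V Q) r None by apply: (@avoid_sub (Some W)); apply/connectP; exists s.
case/and3P: pr => pr pW rW; have pN := connect_trans (connect1 pr) rN.
apply: move_rel_sub pr => i iE iQ.
have iacc : i \in acc by rewrite inE; case/orP: iE => /eqP <-.
split; last exact: (subsetP accQ1).
by apply: agree => //; case/orP: iE => /eqP iE; move: pW rW; rewrite iE (inj_eq Some_inj).
Qed.

End Avoid.

End BoundedColouring.

(** * The exchange step and the induction *)

Section HajnalSzemeredi.

Variables (T C : finType) (e : rel T) (k : nat).
Hypotheses (e_sym : symmetric e) (e_irr : irreflexive e).

Lemma solo_vertex_exists (S B : {set T}) (f : T -> C) (A A' : {set C}) (U : option C) b :
    B \subset S -> {in S :\: B, forall x, f x \in A} ->
    {in S, forall x, #|nb e S x| < #|A| + b} ->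
    {in A, forall i, #|block S B f i| <= k} -> k * b < #|B| ->
    {in B & A, forall y i, nb e (block S B f i) y != set0} ->
    A' \subset A -> 0 < #|A'| ->
    (forall i j x, i \in A' -> x \in block S B f i -> j \in A :\: A' -> Some j != U ->
       nb e (block S B f j) x != set0) ->
  exists z y, [/\ f z \in A', y \in solo_set e S B f z
    & (exists2 i, i \in A :\ f z & nb e (block S B f i) z == set0) \/
      (exists2 y', y' \in solo_set e S B f z & (y' != y) && ~~ e y' y)].
Proof.
move=> BS fA degS block_le B_gt B_nb A'A A'_gt0 A'_nb.
have [/existsP[z /existsP[y /and3P[zA' yz /existsP[i /andP[iA iz]]]]]|move_free] := boolP
  [exists z, exists y, [&& f z \in A', y \in solo_set e S B f z &
     [exists i, (i \in A :\ f z) && (nb e (block S B f i) z == set0)]]].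
  by exists z, y; split=> //; left; exists i.
have [/existsP[z /existsP[y /and3P[zA' yz /existsP[y' /andP[y'z yy']]]]]|clique] := boolP
  [exists z, exists y, [&& f z \in A', y \in solo_set e S B f z &
     [exists y', (y' \in solo_set e S B f z) && ((y' != y) && ~~ e y' y)]]].
  by exists z, y; split=> //; right; exists y'.
exfalso; apply: (solo_false e_sym BS fA degS block_le B_gt B_nb A'A A'_gt0 A'_nb).
- move=> z y i zA' yz iA iz; apply: contra move_free => nz.
  apply/existsP; exists z; apply/existsP; exists y; rewrite zA' yz /=.
  by apply/existsP; exists i; rewrite in_setD1 iz iA.
- move=> z y1 y2 zA' y1z y2z ne; apply: contraNT clique => ney.
  apply/existsP; exists z; apply/existsP; exists y2; rewrite zA' y2z /=.
  by apply/existsP; exists y1; rewrite y1z ne ney.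
Qed.

(** Induction on the number of inaccessible classes, with both the uncoloured vertex and the
    colouring free to change. *)
Lemma colouring_step (Q : {set C}) (S : {set T}) m v (f : T -> C) :
    {in S, forall x, #|nb e S x| < #|Q|} -> #|S| <= k * #|Q| ->
    (forall (Q' : {set C}) (S' : {set T}), #|S'| < #|S| ->
       {in S', forall x, #|nb e S' x| < #|Q'|} -> #|S'| <= k * #|Q'| ->
     exists g, bounded_colouring e k Q' S' g) ->
    v \in S -> bounded_colouring e k Q (S :\ v) f ->
    #|Q :\: acc e k (cls f (S :\ v)) Q| < m ->
  exists g, bounded_colouring e k Q S g.
Proof.
move=> degS cardS IHS; elim: m v f => // m IHm v f vS col; rewrite ltnS => le_m.
set D := S :\ v; set V := cls f D; set A := acc e k V Q.
have AQ : A \subset Q by apply: acc_sub.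
have [fQ fp fk] := col.
have [/exists_inP[j jA nj]|v_nb] := boolP [exists j in A, nb e (V j) v == set0].
  rewrite -(setD1K vS); apply: (shift_connect e_sym e_irr col _ (subsetP AQ j jA) nj).
    by rewrite !inE eqxx.
  by rewrite inE in jA.
have {}v_nb j : j \in A -> nb e (V j) v != set0.
  by move=> jA; apply: contra v_nb => nj; apply/exists_inP; exists j.
pose b := #|Q :\: A|; pose B := [set x in S | (x == v) || (f x \notin A)].
have cardQ : #|A| + b = #|Q| by rewrite -(cardsID A Q) (setIidPr AQ).
have BS : B \subset S by apply/subsetP=> x; rewrite inE => /andP[].
have inSB x : (x \in S :\: B) = (x \in D) && (f x \in A).
  rewrite in_setD in_setD1 [x \in B]inE negb_and negb_or negbK.
  by case: (x \in S); rewrite /= ?andbT ?andbF.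
have VE i : i \in A -> V i = block S B f i.
  move=> iA; apply/setP=> y; rewrite [RHS]inE inSB [LHS]inE -andbA; congr (_ && _).
  by case: eqP => [->|_]; rewrite ?iA ?andbF.
have VQ i : i \in Q :\: A -> #|V i| = k.
  rewrite inE => /andP[iA iQ]; apply/eqP; rewrite eqn_leq fk //= leqNgt.
  apply: contra iA => ltk; rewrite inE; apply: connect1.
  by rewrite /move_rel iQ.
(* Inaccessible classes are full, since a class with room has an arc to the sink; the extra 1 is
   [v]. *)
have cardB : #|B| = (k * b).+1.
  rewrite (cardsD1 v) [v \in B]inE vS eqxx /= add1n; congr _.+1.
  rewrite -sum1_card (partition_big f (mem (Q :\: A))) /= => [|x]; last first.
    rewrite in_setD1 [x \in B]inE in_setD => /andP[xv /andP[xS]]; rewrite (negPf xv) /= => ->.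
    by rewrite fQ // in_setD1 xv.
  rewrite mulnC -sum_nat_const; apply: eq_bigr => i iQA; rewrite sum1_card -(VQ i iQA).
  apply: eq_card => x; rewrite [LHS]unfold_in /= in_setD1 [x \in B]inE [x \in V i]inE in_setD1.
  case: (eqVneq (f x) i) => [fxi|]; rewrite ?andbF // !andbT.
  by move: iQA; rewrite in_setD fxi => /andP[-> _]; rewrite orbT andbT.
have B_nb y i : y \in B -> i \in A -> nb e (V i) y != set0.
  rewrite [y \in B]inE => /andP[yS /orP[/eqP->|yA]] iA; first exact: v_nb.
  have [->|yv] := eqVneq y v; first exact: v_nb.
  have yD : y \in D by rewrite in_setD1 yv.
  apply: contra yA => ny; have [->//|fyi] := eqVneq (f y) i.
  move: (iA); rewrite ![_ \in A]inE => iN.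
  apply: connect_trans (connect1 _) iN; rewrite /move_rel fQ // (subsetP AQ i iA) fyi.
  by apply/exists_inP; exists y => //; rewrite [y \in _]inE yD eqxx.
(* Without accessible classes all classes would be full and [S] would have [k * #|Q| + 1]
   vertices. *)
have A_ne : cut e k V Q None != set0.
  rewrite cut_None -/A; apply: contraTneq cardS => A0; rewrite -ltnNge (cardsD1 v) vS add1n ltnS.
  rewrite -[#|S :\ v|]sum1_card (partition_big f (mem Q)) //= mulnC -sum_nat_const.
  apply: leq_sum => i iQ; rewrite sum1_card.
  have iQA : i \in Q :\: A by rewrite A0 setD0.
  by rewrite -(VQ i iQA); apply: subset_leq_card; apply/subsetP=> x; rewrite inE.
case: (@arg_minnP _ None (fun U => cut e k V Q U != set0) (fun U => #|cut e k V Q U|) A_ne).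
move=> U U_ne U_min.
have cutA : cut e k V Q U \subset A.
  by apply/subsetP=> i; rewrite [i \in cut _ _ _ _ _]inE => /andP[].
have cut_gt0 : 0 < #|cut e k V Q U| by rewrite card_gt0.
have fA : {in S :\: B, forall x, f x \in A} by move=> x; rewrite inSB => /andP[].
have degQ : {in S, forall x, #|nb e S x| < #|A| + b} by rewrite cardQ.
have block_le : {in A, forall i, #|block S B f i| <= k}.
  by move=> i iA; rewrite -VE // fk // (subsetP AQ).
have B_gt : k * b < #|B| by rewrite cardB.
have B_nb' : {in B & A, forall y i, nb e (block S B f i) y != set0}.
  by move=> y i yB iA; rewrite -VE //; apply: B_nb.
have cut_nb i j x : i \in cut e k V Q U -> x \in block S B f i ->
    j \in A :\: cut e k V Q U -> Some j != U -> nb e (block S B f j) x != set0.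
  move=> icut xi; rewrite in_setD => /andP[jcut jA] jU.
  have ij : i != j by apply: contraNneq jcut => <-.
  have iA := subsetP cutA i icut; rewrite -VE //; rewrite -VE // in xi.
  apply: contraNneq jcut => nx; rewrite [_ \in cut _ _ _ _ _]inE jA jU /=.
  move: icut; rewrite [_ \in cut _ _ _ _ _]inE => /and3P[_ iU]; apply: contra => jN.
  apply: connect_trans (connect1 _) jN; rewrite /avoid iU jU !andbT /move_rel.
  by rewrite !(subsetP AQ) //= ij; apply/exists_inP; exists x; rewrite ?nx.
have [z [y1 [zcut y1z alts]]] :=
  solo_vertex_exists BS fA degQ block_le B_gt B_nb' cutA cut_gt0 cut_nb.
set W := f z in zcut alts; have WA := subsetP cutA W zcut.
have y1B : y1 \in B by move: y1z; rewrite inE => /andP[].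
have soloE y : y \in solo_set e S B f z -> nb e (V W) y = [set z].
  by rewrite inE -/W -VE // => /andP[_ /eqP].
have zW : z \in V W.
  have: z \in nb e (V W) y1 by rewrite soloE ?set11.
  by rewrite inE => /andP[].
have zD : z \in D by move: zW; rewrite inE => /andP[].
have zS : z \in S by move: zD; rewrite in_setD1 => /andP[].
pose Av := [set x in D | f x \in A].
have clsA i : i \in A -> cls f Av i = V i.
  move=> iA; apply/setP=> x; rewrite [LHS]inE [x \in Av]inE [RHS]inE -andbA; congr (_ && _).
  by case: eqP => [->|]; rewrite ?andbF ?iA.
have colA : bounded_colouring e k A Av f := colouring_restrict col AQ.
have y1Av : y1 \notin Av.
  rewrite inE; apply/negP=> /andP[y1D y1A]; move: y1B; rewrite [_ \in B]inE y1A orbF.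
  by move: y1D; rewrite in_setD1 => /andP[/negPf-> _]; rewrite andbF.
have zAv : z \in Av by rewrite inE zD.
pose D1 := y1 |: Av :\ z; pose f1 := recolour f y1 W.
have col1 : bounded_colouring e k A D1 f1.
  by apply: colouring_exchange => //; rewrite clsA // soloE.
have cls1 i : i \in A -> cls f1 D1 i = if i == W then y1 |: V W :\ z else V i.
  by move=> iA; rewrite /f1 /D1 cls_exchange // clsA //; case: eqP => // ->.
have [g colg] : exists g, bounded_colouring e k (Q :\: A) (B :\ y1) g.
  have cardB1 : #|B :\ y1| = k * b by move: cardB; rewrite (cardsD1 y1) y1B add1n => -[].
  apply: IHS; rewrite ?cardB1 //.
    by rewrite -ltnS -cardB ltnS subset_leq_card.
  move=> y yB1; have yB : y \in B by move: yB1; rewrite in_setD1 => /andP[].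
  apply: leq_ltn_trans (nb_B_lt BS fA degQ B_nb' yB); apply: subset_leq_card.
  by apply/subsetP=> x; rewrite !inE -!andbA => /and4P[_ -> -> ->].
have dAQ : [disjoint A & Q :\: A] by rewrite -setI_eq0 setIDA setIC setDIl setDv setI0.
have AUQ : A :|: Q :\: A = Q by rewrite setDE setUIr setUCr setIT (setUidPr AQ).
have AvB : Av :|: B = S.
  apply/setP=> x; rewrite in_setU [x \in Av]inE -inSB in_setD; case: (boolP (x \in B)) => xB.
    by rewrite (subsetP BS).
  by rewrite orbF.
have dAvB : [disjoint Av & B].
  rewrite -setI_eq0; apply/eqP/setP=> x; rewrite in_setI [x \in Av]inE -inSB in_setD in_set0.
  by case: (x \in B); rewrite ?andbF.
have glue (f2 : T -> C) (D2 : {set T}) : [disjoint D2 & B :\ y1] -> bounded_colouring e k A D2 f2 ->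
    let h x := if x \in D2 then f2 x else g x in
    [/\ bounded_colouring e k Q (D2 :|: B :\ y1) h
      & {in A, forall i, cls h (D2 :|: B :\ y1) i = cls f2 D2 i}].
  move=> dD2 col2 h; have [fQ2 _ _] := col2; have [gQ _ _] := colg.
  have hD2 : {in D2, f2 =1 h} by move=> x xD; rewrite /h xD.
  have hB : {in B :\ y1, g =1 h} by move=> x xB; rewrite /h (disjointFl dD2 xB).
  split.
    rewrite -AUQ; apply: colouring_union dAQ _ _; first exact: eq_bounded_colouring hD2 col2.
    exact: eq_bounded_colouring hB colg.
  move=> i iA; rewrite (eq_cls i hD2); apply/setP=> x.
  rewrite [LHS]inE [RHS]inE in_setU; case: (boolP (x \in D2)) => //= _.
  apply/negP=> /andP[xB /eqP hx]; have := gQ x xB.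
  by rewrite (hB x xB) hx in_setD iA.
(* By minimality of [U] every other accessible class has a route avoiding [W], so replacing [z] by
   [y1] in [W] does not affect these routes. *)
have accX (V1 : C -> {set T}) (Q1 : {set C}) X :
    A \subset Q1 -> (forall i, i \in A -> i != W -> V i = V1 i) ->
    X \in A -> X != W -> connect (move_rel e k V1 Q1) (Some X) None.
  by move=> AQ1 VV1 XA XW; apply: avoid_transfer AQ1 VV1 _; apply: cut_terminal U_min zcut XA XW.
have [/exists_inP[X XAW zX]|z_stuck] := boolP [exists X in A :\ W, nb e (V X) z == set0].
  have [XW XA] : X != W /\ X \in A by move: XAW; rewrite in_setD1 => /andP.
  have [||||f2 col2] := shift_connect e_sym e_irr (w := z) (j := X) col1.
  - by rewrite !inE eqxx orbF; apply: contraTneq y1Av => <-; rewrite negbK.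
  - by [].
  - by rewrite cls1 // (negPf XW).
  - by apply: (accX _ _ X (subxx A) _ XA XW) => i iA iW; rewrite cls1 // (negPf iW).
  rewrite /D1 setUCA setD1K // in col2.
  have [|col3 _] := glue f2 _ _ col2.
    rewrite -setI_eq0; apply/eqP/setP=> x; rewrite !in_setI in_setU1 in_setD1 in_set0.
    by case: eqP => //= _; case: (boolP (x \in B)) => [/(disjointFl dAvB)->|_]; rewrite ?andbF.
  by rewrite [y1 |: Av]setUC -setUA setD1K // AvB in col3; eexists; apply: col3.
(* Now [z] cannot move: it becomes the new uncoloured vertex, [y1] takes its place, and the
   class of [y2] becomes accessible. *)
have {}z_stuck X : X \in A :\ W -> nb e (V X) z != set0.
  by move=> XAW; apply: contra z_stuck => zX; apply/exists_inP; exists X.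
case: alts => [[X XAW zX]|[y2 y2z /andP[y21 ny]]].
  have := z_stuck X XAW; rewrite VE ?zX //.
  by move: XAW; rewrite in_setD1 => /andP[].
have dD1 : [disjoint D1 & B :\ y1].
  rewrite -setI_eq0; apply/eqP/setP=> x; rewrite !in_setI in_setU1 !in_setD1 in_set0.
  by case: eqP => //= _; case: (boolP (x \in B)) => [/(disjointFl dAvB)->|_]; rewrite ?andbF.
have [colh clsh] := glue f1 D1 dD1 col1.
have zB : z \notin B by rewrite (disjointFr dAvB zAv).
have y2B : y2 \in B by move: y2z; rewrite inE => /andP[].
have y2B1 : y2 \in B :\ y1 by rewrite in_setD1 y21.
set h := fun x => _ in colh clsh.
have DE : D1 :|: B :\ y1 = S :\ z.
  have y1_neq_z : y1 != z by apply: contraNneq zB => <-.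
  apply/setP=> x; rewrite -AvB !in_setU !in_setD1 in_set1 in_setU.
  have [->|xy1] := eqVneq x y1; first by rewrite y1B orbT andbT y1_neq_z.
  by rewrite /= andb_orr; congr (_ || _); have [->|//] := eqVneq x z; rewrite (negPf zB).
rewrite DE in colh clsh; apply: (IHm z h zS colh); apply: leq_trans le_m.
set V1 := cls h (S :\ z).
have V1E i : i \in A -> V1 i = if i == W then y1 |: V W :\ z else V i.
  by move=> iA; rewrite /V1 clsh // cls1.
have accX1 X : X \in A -> X != W -> connect (move_rel e k V1 Q) (Some X) None.
  move=> XA XW; apply: (accX _ _ X AQ _ XA XW) => i iA iW; by rewrite V1E // (negPf iW).
(* The old first step out of [W] is still available: a vertex that could move to another class is
   not [z], which is stuck, and if [W] had room it still does, since its size has not grown. *)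
have accW : connect (move_rel e k V1 Q) (Some W) None.
  have WQ := subsetP AQ W WA.
  move: (WA); rewrite inE => /connectP[p Wp]; case/shortenP: Wp => -[//|r p'] Wp' _ _ lastp'.
  case/andP: Wp' => Wr rp'.
  have racc : connect (move_rel e k V Q) r None by apply/connectP; exists p'.
  move: Wr racc; case: r {rp' lastp'} => [X|] /andP[_].
    case/and3P=> XQ WX /exists_inP[x xW xX] Xacc; have XA : X \in A by rewrite inE.
    apply: connect_trans (connect1 _) (accX1 X XA _); last by rewrite eq_sym.
    rewrite /move_rel WQ XQ WX /=; apply/exists_inP; exists x; last first.
      by rewrite V1E // [X == W]eq_sym (negPf WX).
    rewrite V1E // eqxx in_setU1 in_setD1 xW andbT.
    have -> : x != z; last by rewrite orbT.
    apply: contraTneq xX => ->; apply: z_stuck => //.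
    by rewrite in_setD1 eq_sym WX.
  move=> ltk _; apply: connect1; rewrite /move_rel WQ V1E // eqxx.
  have : #|y1 |: V W :\ z| <= #|V W|.
    by rewrite (cardsD1 z (V W)) zW cardsU1 leq_add2r leq_b1.
  by move/leq_ltn_trans; apply.
have y2h : h y2 = g y2 by rewrite /h (disjointFl dD1 y2B1).
have [gQ _ _] := colg; have := gQ y2 y2B1; rewrite in_setD => /andP[y2A y2Q].
(* The only neighbour of [y2] in the old class [W] was [z], and [y2] is not adjacent to [y1], so
   [y2] can move to the new class [W]. *)
have accy2 : connect (move_rel e k V1 Q) (Some (g y2)) None.
  apply: connect_trans (connect1 _) accW; rewrite /move_rel y2Q (subsetP AQ W WA) /=.
  apply/andP; split; first by apply: contraNneq y2A => ->.
  apply/exists_inP; exists y2.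
    rewrite inE y2h eqxx in_setD1 (subsetP BS) // !andbT.
    by apply: contraNneq zB => <-.
  apply/eqP/setP=> x; rewrite in_set0 inE V1E // eqxx in_setU1 in_setD1.
  apply/negP=> /andP[/orP[/eqP->|/andP[xz xW]] y2x]; first by rewrite y2x in ny.
  have : x \in nb e (V W) y2 by rewrite inE xW.
  by rewrite soloE // in_set1 (negPf xz).
apply: proper_card; apply/properP; split; last first.
  by exists (g y2); rewrite !in_setD ?y2A ?y2Q ?andbT //= negbK inE.
apply/subsetP=> i; rewrite !in_setD => /andP[iN ->]; rewrite andbT; apply: contra iN => iA.
by rewrite inE; have [->|] := eqVneq i W; last exact: accX1.
Qed.

(** The palette [Q] varies in the induction because the exchange step recolours part of [S] with the
    inaccessible colours alone. *)
Theorem hajnal_szemeredi (c0 : C) (Q : {set C}) (S : {set T}) :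
    {in S, forall x, #|nb e S x| < #|Q|} -> #|S| <= k * #|Q| ->
  exists g, bounded_colouring e k Q S g.
Proof.
have [n] := ubnP #|S|; elim: n Q S => // n IHn Q S; rewrite ltnS => le_n degS cardS.
have [->|[v vS]] := set_0Vmem S.
  exists (fun _ => c0); split=> [x|x y|i _]; rewrite ?inE // (_ : cls _ _ _ = set0) ?cards0 //.
  by apply/setP=> x; rewrite !inE.
have ltS : #|S :\ v| < #|S| by rewrite (cardsD1 v S) vS.
have [||| f col] := IHn Q (S :\ v).
- exact: leq_trans ltS le_n.
- move=> x; rewrite in_setD1 => /andP[_ xS]; apply: leq_ltn_trans (degS x xS).
  by apply: subset_leq_card; apply/subsetP=> y; rewrite !inE -andbA => /and3P[_ -> ->].
- exact: leq_trans (ltnW ltS) cardS.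
apply: (colouring_step degS cardS _ vS col (ltnSn _)) => Q' S' ltS'.
exact: IHn (leq_trans ltS' le_n).
Qed.

End HajnalSzemeredi.

(** * Total colourings *)

Lemma edge_endpoints (G : sgraph) (a : edge G) :
  exists xy : G * G, adj xy.1 xy.2 && (val a == [set xy.1; xy.2]).
Proof. by have := valP a; rewrite inE => /existsP[x /existsP[y xyE]]; exists (x, y). Qed.

(** An edge is an unordered pair, so its ends are picked by choice; symmetry of [phi] makes the
    order irrelevant, and adjacency of the ends means that the default colour never occurs. *)
Lemma total_colorable_glue (G : sgraph) q (c : G -> 'I_q) phi :
    (forall x y, adj x y -> c x != c y) -> edge_colouring c (@adj G) phi ->
  total_colorable G q.
Proof.
move=> cp [s d p n].
pose ends (a : edge G) := xchoose (@edge_endpoints G a).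
pose col (w : element G) := match w with
  | inl x => c x
  | inr a => odflt (c (ends a).1) (phi (ends a).1 (ends a).2)
  end.
have endsP (a : edge G) : adj (ends a).1 (ends a).2 /\ val a = [set (ends a).1; (ends a).2].
  by have /andP[? /eqP] := xchooseP (edge_endpoints a).
have colE (a : edge G) x : x \in val a ->
    exists2 y, val a = [set x; y] & phi x y = Some (col (inr a)).
  have [adj_a aE] := endsP a; rewrite {1}aE !inE /=.
  have := d (ends a).1 (ends a).2; rewrite adj_a; case E: (phi _ _) => [i|//] _ /=.
  by case/orP=> /eqP->; [exists (ends a).2 | exists (ends a).1; rewrite 1?setUC 1?s].
apply/existsP; exists [ffun w => col w]; apply/and3P; split;
  apply/forallP=> x; apply/forallP=> y; apply/implyP; rewrite !ffunE.
- exact: cp.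
- case/andP=> xy /set0Pn[z]; rewrite inE => /andP[/colE[x' xE zx'] /colE[y' yE zy']].
  apply: contra xy => /eqP ce; apply/eqP/val_inj; rewrite xE yE.
  by rewrite ce in zx'; rewrite (p _ _ _ _ zx' zy').
- by case/colE=> z _ xz; apply: contra (n x z) => /eqP ce; rewrite xz -ce.
Qed.

Lemma total_chromatic_le (G : sgraph) k : 0 < k -> #|G| <= k * (max_degree G).+1 ->
  total_chromatic_number G <= max_degree G + k.*2.
Proof.
move=> k_gt0 cardG; rewrite /total_chromatic_number; case: ex_minnP => m _; apply.
set D := max_degree G in cardG *.
have deg (x : G) : #|[set y | adj x y]| <= D.
  exact: (@leq_bigmax _ (fun x : G => #|nbhd x|)).
have [q qE] : exists q, D + k.*2 = q.+1 by exists (D + k.*2).-1; lia.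
rewrite qE.
have le_Dq : D.+1 <= q.+1 by lia.
(* The vertices use only [D + 1] colours of the common palette; the edges may use all of it. *)
pose Q := [set widen_ord le_Dq i | i : 'I_D.+1].
have card_Q : #|Q| = D.+1.
  by rewrite card_imset ?card_ord // => i j /(congr1 val) ij; apply: val_inj.
have [||c [cQ cp ck]] := @hajnal_szemeredi G _ (@adj G) k (@adj_sym G) (@adj_irr G) ord0 Q setT.
- move=> x _; rewrite card_Q ltnS; apply: leq_trans (deg x).
  by apply: subset_leq_card; apply/subsetP=> y; rewrite !inE.
- by rewrite card_Q cardsT.
have [||||phi col] := @edge_colouring_exists G _ c (@adj G) D k (@adj_sym G) (@adj_irr G).
- exact: deg.
- move=> i; have [iQ|iNQ] := boolP (i \in Q).
    by apply: leq_trans (ck i iQ); apply: subset_leq_card; apply/subsetP=> x; rewrite !inE.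
  rewrite (_ : [set _ | _] = set0) ?cards0 //; apply/setP=> x; rewrite !inE.
  by apply: contraNF iNQ => /eqP <-; apply: cQ.
- by [].
- by rewrite card_ord qE.
by apply: total_colorable_glue col => x y xy; apply: cp; rewrite ?inE.
Qed.

Lemma total_chromatic_empty (G : sgraph) : #|G| = 0 -> total_chromatic_number G = 0.
Proof.
move=> G0; have noG (x : G) : False by have := fintype0 x G0.
apply/eqP; rewrite -leqn0 /total_chromatic_number; case: ex_minnP => m _; apply.
apply: (@total_colorable_glue G 0 (fun x => False_rect _ (noG x)) (fun _ _ => None)).
  by move=> x; case: (noG x).
by split=> x; case: (noG x).
Qed.

Local Open Scope ring_scope.

Theorem theorem1 (G : sgraph) :
  (total_chromatic_number G)%:Z <=
    (max_degree G)%:Z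
      + 2 * Num.ceil ((#|G|%:R : rat) / ((max_degree G)%:R + 1)).
Proof.
set D := max_degree G; set r := (X in Num.ceil X).
have D1_gt0 : 0 < (D%:R + 1 : rat) by rewrite ltr_wpDl.
have r_ge0 : 0 <= r by rewrite divr_ge0 // ltW.
have [k kE] : exists k : nat, Num.ceil r = k%:Z.
  have : 0 <= Num.ceil r by rewrite -(ceil0 rat); apply: le_ceil.
  by case: (Num.ceil r) => // k _; exists k.
have cardG : (#|G| <= k * D.+1)%N.
  have := ceil_ge r; rewrite kE /r ler_pdivrMr //.
  by rewrite natr1 -pmulrn -natrM ler_nat.
rewrite kE.
(* The value [k = 0] occurs only for the empty graph, which needs no colour. *)
have [k0|k_gt0] := posnP k.
  have G0 : #|G| = 0%N by move: cardG; rewrite k0 mul0n leqn0 => /eqP.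
  by rewrite k0 total_chromatic_empty.
have := total_chromatic_le k_gt0 cardG; rewrite -/D; lia.
Qed.
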